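(* Fix integers $m,r\ge1$, and assume $p_b>0$. Let $n_k:=1+kr+(k-1)$ for $k\ge1$. Then, for every $x\in\mathbb R$, $$\liminf_{k\to\infty} n_k^{-1}\log\mathbb P\bigl(n_k^{-1}\log N_{n_k}>x\bigr)\ge -J_{r,m}^{+}(x).$$
   Context: Random tent model. Fix $0<\varepsilon<1$. For $a,b>0$ let $h(a,b):=ab/(a+b)$, and let $U_\varepsilon:=\{(a,b)\in(0,\infty)^2: |a-2|\le\varepsilon,\ |b-2|\le\varepsilon,\ h(a,b)\le1\}$. Let $\mu_\varepsilon$ be a probability measure supported on $U_\varepsilon$ and let $(\omega_n)_{n\ge1}$ be i.i.d. with law $\mu_\varepsilon$. For $\omega=(a,b)\in U_\varepsilon$ put $c(\omega):=b/(a+b)$, $h(\omega):=ab/(a+b)$, $\eta(\omega):=1-h(\omega)$, and $T_\omega(x):=\max\{0,\min(ax,b(1-x))\}$, which maps $[0,1]$ into $[0,1]$. Set $F_n:=T_{\omega_n}\circ\cdots\circ T_{\omega_1}$ and let $N_n$ be the smallest number of subintervals partitioning $[0,1]$ on each of which $F_n$ is affine. Coarse symbols. Put $\delta_\varepsilon:=\frac12\inf_{\omega\in U_\varepsilon}\min\{c(\omega),1-c(\omega)\}=(2-\varepsilon)/8$, $K_\varepsilon:=2+\varepsilon$ and $r_i:=\delta_\varepsilon K_\varepsilon^{-i}$ for $i=0,\dots,m$ (the thresholds $r_i$ are not to be confused with the integer $r$). Let $\mathcal A_m:=\{0,1,\dots,m,\partial\}$. Define $\kappa_m(\omega):=\max\{\ell\in\{0,\dots,m\}:\eta(\omega)\le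 r_\ell\}$ if $\eta(\omega)\le r_0$, and $\kappa_m(\omega):=\partial$ otherwise. Let $\pi$ be the law of $\kappa_m(\omega_1)$ on $\mathcal A_m$. Transfer maps. Let $\Sigma_m:=\{(i,j):0\le i,j\le m\}$ and consider the real vector space with basis $\{e_{(i,j)}:(i,j)\in\Sigma_m\}$. For $a\in\{0,\dots,m\}$ define the linear map $M(a)$ by $M(a)e_{(i,j)}:=\mathbf 1_{\{i\ge1\}}e_{(i-1,a)}+\mathbf 1_{\{j\ge1\}}e_{(j-1,a)}$, and set $M(\partial):=0$. For a word $w=(a_1,\dots,a_\ell)$ over $\mathcal A_m$, read from left to right, $M(w):=M(a_\ell)\cdots M(a_1)$. Let $s_i:=(i,m)$ for $i=0,\dots,m-1$, $F_m:=\operatorname{span}\{e_{s_i}:0\le i\le m-1\}$, let $P_F$ be the coordinate projection onto $F_m$, $\mathbf 1_F$ the vector on $F_m$ with all coordinates equal to one in the basis $(e_{s_i})$, and $e_\star:=e_{(m-1,m)}$. Define $\Gamma(w):=\mathbf 1_F^\top P_FM(w)e_\star$. Rate. Let $\mathcal W_r:=\mathcal A_m^r$, $\pi_r:=\pi^{\otimes r}$, $\mathcal G_r:=\{w\in\mathcal W_r:\Gamma(w)>0\}$, and $g_r(w):=\log\Gamma(w)$ for $w\in\mathcal G_r$. The bridge word is the one-letter word $b^{(m)}=(m)$ and $p_b:=\pi(m)=\mathbb P(\kappa_m(\omega_1)=m)$. With $\mathcal P(\mathcal W_r)$ the set of probability measures on $\mathcal W_r$ and $H(\nu\mid\pi_r)$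 the relative entropy (equal to $+\infty$ if $\nu\not\ll\pi_r$), define $$J_{r,m}^{+}(x):=\inf\Bigl\{\frac{H(\nu\mid\pi_r)-\log p_b}{r+1}:\ \nu\in\mathcal P(\mathcal W_r),\ \nu(\mathcal G_r)=1,\ \int g_r\,d\nu>(r+1)x\Bigr\},$$ with the infimum over the empty set equal to $+\infty$. *)

(* Defs.v *)
From HB Require Import structures.
From mathcomp Require Import all_boot all_order all_algebra.
From mathcomp Require Import ring lra.
From mathcomp Require Import all_classical all_reals all_analysis.
Import Order.TTheory GRing.Theory Num.Theory.
Import numFieldNormedType.Exports.

Set Implicit Arguments.
Unset Strict Implicit.
Unset Printing Implicit Defensive.

Local Open Scope classical_set_scope.
Local Open Scope ring_scope.

(* The parameter plane (a, b), with its product Borel sigma-algebra. *)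
Notation param R := (measurableTypeR R * measurableTypeR R)%type.

Section TentMaps.
Context {R : realType}.
Implicit Types (w : param R) (eps : R).

Definition tent_h w : R := w.1 * w.2 / (w.1 + w.2).
Definition tent_c w : R := w.2 / (w.1 + w.2).
Definition tent_eta w : R := 1 - tent_h w.

Definition tent_dom eps : set (param R) :=
  [set w | [/\ 0 < w.1, 0 < w.2, `|w.1 - 2| <= eps, `|w.2 - 2| <= eps
             & tent_h w <= 1]].

Definition tent w (x : R) : R :=
  Num.max 0 (Num.min (w.1 * x) (w.2 * (1 - x))).

(* Sequences of parameters are indexed from 0: u n is the (n+1)-st one. *)
Fixpoint tent_iter (u : nat -> param R) (n : nat) (x : R) : R :=
  if n is k.+1 then tent (u k) (tent_iter u k x) else x.

Definition affine_on (A : set R) (f : R -> R) : Prop :=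
  exists p q : R, forall x, A x -> f x = p * x + q.

Definition affine_partition (f : R -> R) (k : nat) : Prop :=
  exists I : 'I_k -> set R,
    [/\ forall i, I i !=set0 /\ is_interval (I i),
        trivIset [set: 'I_k] I,
        \bigcup_i I i = `[0, 1]%classic
      & forall i, affine_on (I i) f].

(* The default value 0 is taken only if there is no finite partition. *)
Definition num_pieces (f : R -> R) : nat :=
  xget 0%N [set k | affine_partition f k /\
                    forall j, affine_partition f j -> (k <= j)%N].

Definition delta eps : R :=
  2^-1 * inf [set Num.min (tent_c w) (1 - tent_c w) | w in tent_dom eps].

Definition Kcst eps : R := 2 + eps.

Definition rthr eps (i : nat) : R := delta eps * Kcst eps ^- i.

Lemma deltaE eps : 0 < eps < 1 -> delta eps = (2 - eps) / 8.
Proof.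
move=> /andP[e0 e1]; rewrite /delta.
set S := image _ _.
suff -> : inf S = (2 - eps) / 4 by field.
have lbS : lbound S ((2 - eps) / 4).
  move=> _ [[a b] [/= a0 b0 + + _] <-].
  rewrite !ler_norml => /andP[a1 a2] /andP[b1 b2].
  have ab0 : 0 < a + b by rewrite addr_gt0.
  rewrite /tent_c /= le_min; apply/andP; split.
    by rewrite ler_pdivlMr//; nra.
  have -> : 1 - b / (a + b) = a / (a + b) by field; rewrite gt_eqF.
  by rewrite ler_pdivlMr//; nra.
have inS : S ((2 - eps) / 4).
  exists (2 - eps, 2 + eps); last first.
    rewrite /tent_c /= (_ : 2 - eps + (2 + eps) = 4); last by ring.
    by rewrite min_r; lra.
  split => /=; rewrite ?ler_norml; try lra.
  by rewrite /tent_h /= ler_pdivrMr; nra.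
apply/eqP; rewrite eq_le; apply/andP; split.
  by apply: ge_inf => //; exists ((2 - eps) / 4).
by apply: lb_le_inf => //; exists ((2 - eps) / 4).
Qed.

End TentMaps.

(* Symbols: Some l is the letter l in {0, ..., m}, None is the letter
   "partial"; words of length l are l-tuples of letters. *)
Definition alphabet (m : nat) : finType := option 'I_m.+1.

Section Coarse.
Context {R : realType}.

Definition kappa (eps : R) (m : nat) (w : param R) : alphabet m :=
  if tent_eta w <= rthr eps 0 then
    Some [arg max_(l > ord0 | (tent_eta w <= rthr eps l)%R) l]%N
  else None.

Definition kappa_law d (T : measurableType d) (P : probability T R)
    (eps : R) (m : nat) (X : T -> param R) (a : alphabet m) : R :=
  fine (P [set t | kappa eps m (X t) = a]).

Variable m : nat.

Definition Sigma : finType := ('I_m.+1 * 'I_m.+1)%type.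
Definition vec : lmodType R := {ffun Sigma -> R^o}.

Definition ebasis (s : Sigma) : vec := [ffun t => (t == s)%:R].

Definition transfer_basis (a : 'I_m.+1) (s : Sigma) : vec :=
  (if (0 < s.1)%N then ebasis (inord s.1.-1, a) else 0) +
  (if (0 < s.2)%N then ebasis (inord s.2.-1, a) else 0).

Definition transfer (a : alphabet m) (v : vec) : vec :=
  if a is Some l then \sum_(s : Sigma) (v s : R) *: transfer_basis l s else 0.

Lemma transfer_ebasis (l : 'I_m.+1) (s : Sigma) :
  transfer (Some l) (ebasis s) = transfer_basis l s.
Proof.
rewrite /transfer (bigD1 s)//= !ffunE eqxx scale1r big1 ?addr0// => t tNs.
by rewrite ffunE (negbTE tNs) scale0r.
Qed.

(* The first letter of the word acts first. *)
Definition transfer_word (w : seq (alphabet m)) (v : vec) : vec :=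
  foldl (fun u a => transfer a u) v w.

Definition sstate (i : 'I_m) : Sigma := (widen_ord (leqnSn m) i, ord_max).

(* Coordinates, in the basis (e_{s_i})_{i < m}, of the projection onto F_m. *)
Definition projF (v : vec) : 'cV[R]_m := \col_i v (sstate i).

Definition oneF : 'cV[R]_m := const_mx 1.

Definition estar : vec := ebasis (inord m.-1, ord_max).

Definition Gam (w : seq (alphabet m)) : R :=
  (oneF^T *m projF (transfer_word w estar)) 0 0.

End Coarse.
Arguments kappa_law {R d T} P eps m X a.

Section Rate.
Context {R : realType} (W : finType).
Implicit Types nu q : W -> R.

Definition is_pmf nu : Prop := (forall w, 0 <= nu w) /\ \sum_w nu w = 1.

(* The terms with nu w = 0 vanish. *)
Definition rel_entropy nu q : \bar R :=
  if `[< forall w, q w = 0 -> nu w = 0 >]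
  then (\sum_w nu w * ln (nu w / q w))%:E else +oo%E.

End Rate.

Section RateFunction.
Context {R : realType} (m r : nat) (p : alphabet m -> R).

Definition prod_law (w : r.-tuple (alphabet m)) : R :=
  \prod_(i < r) p (tnth w i).

Definition Ggood : {set r.-tuple (alphabet m)} :=
  [set w : r.-tuple (alphabet m) | (0 : R) < Gam w]%SET.

(* The bridge word consists of the single letter m. *)
Definition bridge_prob : R := p (Some ord_max).

Definition Jplus (x : R) : \bar R :=
  ereal_inf
    [set ((rel_entropy nu prod_law - (ln bridge_prob)%:E)
            * (r.+1%:R^-1)%:E)%E
    | nu in [set nu : r.-tuple (alphabet m) -> R |
        [/\ is_pmf nu,
            \sum_(w in Ggood) nu w = 1
          & r.+1%:R * x < \sum_(w in Ggood) nu w * ln (Gam w)]]].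

End RateFunction.

Section Iid.
Context {R : realType} d (T : measurableType d) (P : probability T R)
  d' (S : measurableType d').

Definition mutually_independent (X : nat -> {RV P >-> S}) : Prop :=
  forall (J : seq nat) (A : nat -> set S), uniq J ->
    (forall n, measurable (A n)) ->
    (P (\bigcap_(n in [set` J]) (X n @^-1` A n)) =
     \prod_(n <- J) P (X n @^-1` A n))%E.

Definition iid (mu : probability S R) (X : nat -> {RV P >-> S}) : Prop :=
  (forall n (A : set S), measurable A -> distribution P (X n) A = mu A) /\
  mutually_independent X.

End Iid.

(* Main.v *)
(* The proof follows laps: subintervals of [0, 1] on whose ends F_n takes a value
   at most r_i and a value at least 1 - r_j, state (i, j). By the intermediate
   value theorem F_n meets the turning point c inside such a lap, so one more
   step splits it into two laps, in states (i - 1, a) and (j - 1, a), where a is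
   the symbol of the new parameter: the counting vector of the laps evolves by
   the transfer maps. The letter m turns every lap in a state (i, m) into one in
   the state e_star, so the numbers Gamma(w_j) multiply along the word
   m w_1 m w_2 ... m w_k, and as each lap crosses the height 1/2 strictly between
   its ends, N_n is at least their product. By independence the probability of
   the words with a large product is that of a sum of k i.i.d. variables on a
   finite set, which is bounded below by tilting to nu and the weak law.

   The probability P is only controlled on measurable sets, so the event on N_n
   has to be shown measurable: N_n > k holds if and only if there is a chain of
   rational points 0 = x_0 < ... < x_k <= 1 with F_n affine on no
   [x_i, x_(i+1)]. *)
Require Import Defs.
From HB Require Import structures.
From mathcomp Require Import all_boot all_order all_algebra.
From mathcomp Require Import ring lra.
From mathcomp Require Import all_classical all_reals all_analysis.
From mathcomp Require Import measurable_realfun.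
Import Order.TTheory GRing.Theory Num.Theory.
Import numFieldNormedType.Exports.
Set Implicit Arguments.
Unset Strict Implicit.
Unset Printing Implicit Defensive.

Local Open Scope classical_set_scope.
Local Open Scope ring_scope.

(** * Affine partitions and off-chord chains *)

Section Pieces.
Context {R : realType}.
Implicit Types (f : R -> R) (x y z : R).

Definition off_chord f x y : Prop := exists2 s, x < s < y &
  f s * (y - x) != f x * (y - s) + f y * (s - x).

Lemma off_chord_lt f x y : off_chord f x y -> x < y.
Proof. by case=> s /andP[xs sy] _; apply: lt_trans xs sy. Qed.

Lemma off_chordP f x y : x < y ->
  off_chord f x y <-> ~ affine_on `[x, y]%classic f.
Proof.
move=> xy; split.
  move=> [s /andP[xs sy] /eqP off] [p [q aff]]; apply: off.
  by rewrite !aff /= ?in_itv /= ?lexx ?(ltW xs) ?(ltW sy) ?(ltW xy)//; ring.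
move=> naff; apply: contrapT => noff; apply: naff.
have d0 : y - x != 0 by rewrite subr_eq0 gt_eqF.
exists ((f y - f x) / (y - x)), ((f x * y - f y * x) / (y - x)) => s /=.
rewrite in_itv /= => /andP[xs sy].
have [<-|sx] := eqVneq x s; first by field.
have [->|sy'] := eqVneq s y; first by field.
have : f s * (y - x) = f x * (y - s) + f y * (s - x).
  apply/eqP; apply: contrapT => /negP off; apply: noff; exists s => //.
  by rewrite !lt_neqAle sx xs sy sy'.
move=> e; apply: (mulIf d0); rewrite e; field; exact: d0.
Qed.

Lemma affine_on_sub (A B : set R) f : A `<=` B -> affine_on B f -> affine_on A f.
Proof. by move=> AB [p [q aff]]; exists p, q => x /AB/aff. Qed.

(* Two points of one piece cannot be separated by an off-chord point. *)
Lemma size_off_chord_le f k (X : seq R) : affine_partition f k ->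
  {in X, forall x, 0 <= x <= 1} ->
  pairwise (fun x y => `[< off_chord f x y >]) X -> (size X <= k)%N.
Proof.
move=> [I [ivI disj cov aff]] X01 pw.
have pick x : x \in X -> exists i : 'I_k, I i x.
  move=> /X01 x01; have : (\bigcup_i I i) x by rewrite cov /= in_itv.
  by move=> [i _ Iix]; exists i.
have uX : uniq X.
  elim: X pw {X01 pick} => //= x X ih /andP[/allP h /ih ->]; rewrite andbT.
  by apply/negP => /h /asboolP /off_chord_lt; rewrite ltxx.
have /choice[g gP] (x : R) : exists i : option 'I_k,
    x \in X -> exists2 j, i = Some j & I j x.
  have [/pick[i Ii]|_] := boolP (x \in X); last by exists None.
  by exists (Some i) => _; exists i.
have same x y i : I i x -> I i y -> off_chord f x y -> False.
  move=> ix iy oc; have xy := off_chord_lt oc.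
  move/off_chordP: oc => /(_ xy); apply; apply: affine_on_sub (aff i) => z /=.
  by rewrite in_itv/=; have [_] := ivI i; apply.
have order x y : x \in X -> y \in X -> x != y ->
    off_chord f x y \/ off_chord f y x.
  elim: X pw {uX X01 pick gP} => //= a X ih /andP[/allP h /ih{}ih].
  rewrite !inE => /predU1P[->|xX] /predU1P[->|yX]; rewrite ?eqxx// => xy.
  - by left; apply/asboolP/h.
  - by right; apply/asboolP/h.
  - exact: ih.
have ginj : {in X &, injective g}.
  move=> x y xX yX gxy; apply/eqP; apply: contrapT => /negP xy.
  have [i gx Ix] := gP _ xX; have [j gy Iy] := gP _ yX.
  move: gxy Iy; rewrite gx gy => -[<-] Iy.
  by case: (order _ _ xX yX xy) => /same; apply; eassumption.
have := uniq_leq_size (s1 := map g X) (s2 := map Some (enum (ordinal k))).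
rewrite 2!size_map -cardE card_ord; apply.
  by rewrite map_inj_in_uniq.
move=> _ /mapP[x xX ->]; have [j -> _] := gP _ xX.
by rewrite mem_map ?mem_enum// => ? ? [].
Qed.

End Pieces.

Section Covers.
Context {R : realType}.
Implicit Types (f : R -> R) (x y z : R) (A B : set R).

Definition affine_cover (J : finType) A f : Prop :=
  exists I : J -> set R, [/\ forall i, is_interval (I i),
    trivIset [set: J] I, \bigcup_i I i = A & forall i, affine_on (I i) f].

Lemma affine_cover_partition (J : finType) f : affine_cover J `[0, 1]%classic f ->
  exists2 k, (k <= #|J|)%N & affine_partition f k.
Proof.
move=> [I [ivI disj cov aff]].
pose S := [set j | `[< I j !=set0 >]]%SET.
exists #|S|; first exact: max_card.
exists (fun i => I (enum_val i)); split => //.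
- move=> i; split => //; have := enum_valP i; rewrite inE => /asboolP; exact.
- move=> i j _ _ /disj => /(_ Logic.I Logic.I); exact: enum_val_inj.
- rewrite -cov; apply/seteqP; split => x [i _ Ix]; first by exists (enum_val i).
  have iS : i \in S by rewrite inE; apply/asboolP; exists x.
  by exists (enum_rank_in iS i) => //; rewrite enum_rankK_in.
Qed.

Lemma affine_cover_affine k A f : is_interval A -> affine_on A f ->
  affine_cover 'I_k.+1 A f.
Proof.
move=> ivA affA; exists (fun i => if i == ord0 then A else set0).
split => [i|i j _ _||i]; try by case: ifP.
- by case: eqP => // _ x y [].
- by do 2![case: eqP => [->|_]] => //; rewrite ?setI0 ?set0I => -[].
- apply/seteqP; split => x; first by move=> [i _]; case: ifP.
  by move=> Ax; exists ord0.
- case: ifP => // _; exists 0, 0 => x [].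
Qed.

Lemma affine_coverU k A B f : is_interval B -> affine_on B f ->
  A `&` B = set0 -> affine_cover 'I_k A f -> affine_cover 'I_k.+1 (B `|` A) f.
Proof.
move=> ivB affB AB [I [ivI disj cov aff]].
exists (fun i => if unlift ord0 i is Some j then I j else B); split.
- by move=> i; case: unliftP.
- have nB j : B `&` I j !=set0 -> False.
    move=> [x [Bx Ix]]; suff : (A `&` B) x by rewrite AB.
    by split => //; rewrite -cov; exists j.
  move=> i j _ _; case: unliftP => [i' ->|->]; case: unliftP => [j' ->|->] //.
  + by move=> /disj-> .
  + by rewrite setIC => /nB.
  + by move=> /nB.
- rewrite -cov; apply/seteqP; split => x.
    by move=> [i _]; case: unliftP => [j _|_ //]; [right; exists j | left].
  move=> [Bx|[j _ Ix]]; first by exists ord0 => //; rewrite unlift_none.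
  by exists (lift ord0 j) => //; rewrite liftK.
- by move=> i; case: unliftP.
Qed.

Lemma off_chord_near_r f x y : continuous f -> off_chord f x y ->
  \forall y' \near y, off_chord f x y'.
Proof.
move=> cf [s /andP[xs sy] off].
pose g z := f s * (z - x) - (f x * (z - s) + f z * (s - x)).
have cg : continuous g.
  move=> z; rewrite /g; apply: cvgB; last apply: cvgD.
  - apply: cvgM; [exact: cvg_cst|apply: cvgB; [exact: cvg_id|exact: cvg_cst]].
  - apply: cvgM; [exact: cvg_cst|apply: cvgB; [exact: cvg_id|exact: cvg_cst]].
  - by apply: cvgM; [exact: cf|exact: cvg_cst].
have g0 : g y != 0 by rewrite /g subr_eq0.
have := cvgr_neq0 _ (cg y) g0.
move=> h; near=> z; exists s; first by rewrite xs /=; near: z; exact: lt_nbhsr.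
by rewrite -subr_eq0; near: z; exact: h.
Unshelve. all: by end_near. Qed.

Lemma off_chord_near_l f x y : continuous f -> off_chord f x y ->
  \forall x' \near x, off_chord f x' y.
Proof.
move=> cf [s /andP[xs sy] off].
pose g z := f s * (y - z) - (f z * (y - s) + f y * (s - z)).
have cg : continuous g.
  move=> z; rewrite /g; apply: cvgB; last apply: cvgD.
  - apply: cvgM; [exact: cvg_cst|apply: cvgB; [exact: cvg_cst|exact: cvg_id]].
  - by apply: cvgM; [exact: cf|exact: cvg_cst].
  - apply: cvgM; [exact: cvg_cst|apply: cvgB; [exact: cvg_cst|exact: cvg_id]].
have g0 : g x != 0 by rewrite /g subr_eq0.
have := cvgr_neq0 _ (cg x) g0.
move=> h; near=> z; exists s; first by rewrite sy andbT; near: z; exact: lt_nbhsl.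
by rewrite -subr_eq0; near: z; exact: h.
Unshelve. all: by end_near. Qed.

Lemma sup_affine f x : continuous f -> x <= 1 -> ~ affine_on `[x, 1]%classic f ->
  exists beta, [/\ x <= beta < 1, affine_on `[x, beta]%classic f &
    forall z, beta < z <= 1 -> off_chord f x z].
Proof.
move=> cf x1 naff.
pose S := [set y | x <= y <= 1 /\ affine_on `[x, y]%classic f].
have Sx : S x.
  split; first by rewrite lexx.
  exists 0, (f x) => z /=; rewrite in_itv/= => /le_anti ->; lra.
have ubS : ubound S 1 by move=> y [/andP[]].
have supS : has_sup S by split; [exists x|exists 1].
have xb : x <= sup S by apply: ub_le_sup => //; exists 1.
have b1 : sup S <= 1 by apply: ge_sup => //; exists x.
have affb : affine_on `[x, sup S]%classic f.
  apply: contrapT => nb.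
  have xltb : x < sup S.
    rewrite lt_neqAle xb andbT; apply/eqP => e; apply: nb; rewrite -e.
    by case: Sx.
  move/(off_chordP _ xltb): nb => /(off_chord_near_r cf)[e /= e0 eP].
  have [y Sy yb] := sup_adherent e0 supS.
  have yle : y <= sup S by apply: ub_le_sup => //; exists 1.
  have oc : off_chord f x y.
    by apply: eP; rewrite /= ger0_norm ?subr_ge0// ltrBlDr addrC -ltrBlDr.
  have := off_chord_lt oc => xy; move/(off_chordP _ xy): oc; apply.
  by case: Sy.
exists (sup S); split => //.
  rewrite xb lt_neqAle b1 andbT; apply/eqP => e; apply: naff; by rewrite -e.
move=> z /andP[bz z1]; have xz : x < z by apply: le_lt_trans bz.
apply/(off_chordP _ xz) => az; have : S z by split => //; rewrite z1 ltW.
by move=> /(ub_le_sup (ex_intro _ _ ubS)); rewrite leNgt bz.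
Qed.

Fixpoint off_chain f x (X : seq rat) : Prop :=
  if X is q :: X' then
    [/\ off_chord f x (ratr q), ratr q <= 1 :> R & off_chain f (ratr q) X']
  else True.

Lemma off_chain_exists f k b x : continuous f -> x <= 1 ->
  ~ affine_cover 'I_k [set` Interval (BSide b x) (BRight 1)] f ->
  exists2 X, size X = k & off_chain f x X.
Proof.
move=> cf; elim: k b x => [|k ih] b x x1 ncov; first by exists [::].
have naff : ~ affine_on `[x, 1]%classic f.
  move=> aff; apply: ncov; apply: affine_cover_affine; first exact: interval_is_interval.
  by apply: affine_on_sub aff; apply: subset_itvr; case: (b); rewrite bnd_simp.
have [be [/andP[xb b1] affb offb]] := sup_affine cf x1 naff.
have [X sX chX] : exists2 X, size X = k & off_chain f be X.
  apply: (ih false) => [|cov]; first exact: ltW.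
  apply: ncov.
  rewrite (_ : [set` _] =
    [set` Interval (BSide b x) (BRight be)] `|`
    [set` Interval (BSide false be) (BRight 1)]).
    apply: affine_coverU => //; first exact: interval_is_interval.
      by apply: affine_on_sub affb; apply: subset_itvr; case: (b); rewrite bnd_simp.
    apply/seteqP; split => // z [/=]; rewrite !itv_boundlr /= !bnd_simp.
    by move=> /andP[bz _] /andP[_ zb]; have := le_lt_trans zb bz; rewrite ltxx.
  by rewrite -itv_bndbnd_setU ?bnd_simp ?(ltW b1)//; case: (b); rewrite bnd_simp.
case: X sX chX => [sk _|q X sX /= [oq q1 ch]].
  exists [:: 1]; first by rewrite -sk.
  by rewrite /= rmorph1 lexx; split => //; apply: offb; rewrite b1 lexx.
have := off_chord_near_l cf oq => -[e /= e0 eP].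
have : be < Num.min 1 (be + e) by rewrite lt_min b1 ltrDl e0.
move=> /rat_in_itvoo[z]; rewrite in_itv/= lt_min => /andP[bz /andP[z1 ze]].
exists [:: z, q & X]; first by rewrite /= -sX.
split => //=.
- by apply: offb; rewrite bz ltW.
- exact: ltW.
- split => //; apply: eP => /=; rewrite distrC ger0_norm ?subr_ge0 1?ltW//.
  by rewrite ltrBlDr addrC.
Qed.

Lemma off_chain_size f k (q : rat) (X : seq rat) : affine_partition f k ->
  0 <= (ratr q : R) <= 1 -> off_chain f (ratr q) X -> (size X < k)%N.
Proof.
move=> pf q01 ch; rewrite -[(size X).+1]/(size (q :: X)) -(size_map (ratr : rat -> R)).
have tr : {in predT & &, transitive (fun x y : R => `[< off_chord f x y >])}.
  move=> y x z _ _ _ /asboolP xy /asboolP yz; apply/asboolP.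
  have ltxy := off_chord_lt xy; have ltyz := off_chord_lt yz.
  apply/off_chordP; first exact: lt_trans ltyz.
  move=> aff; move/(off_chordP _ ltxy): xy; apply.
  by apply: affine_on_sub aff; apply: subset_itvl; rewrite bnd_simp ltW.
apply: (size_off_chord_le pf).
  elim: X q q01 ch => [|q' X ih] q q01 /=; first by move=> _ x; rewrite !inE => /eqP->.
  move=> [/off_chord_lt qq' q'1 /ih{}ih] x; rewrite inE => /predU1P[->//|].
  by apply: ih; rewrite q'1 andbT (le_trans _ (ltW qq')) //; case/andP: q01.
rewrite -(sorted_pairwise_in tr); last exact: all_predT.
elim: X q q01 ch => //= q' X ih q /andP[q0 _] [qq' q'1 /ih{}ih].
rewrite ih ?q'1 ?andbT; first exact/asboolP.
by rewrite (le_trans q0) // ltW // (off_chord_lt qq').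
Qed.

End Covers.

Section TentPieces.
Context {R : realType}.
Implicit Types (f : R -> R) (x y z : R) (A B : set R) (w : param R).

Lemma affine_le_interval (I : set R) f (a b a' b' : R) (c : bool) :
  is_interval I -> affine_on I f ->
  is_interval (I `&` [set x | (a * f x + b <= a' * f x + b') = c]).
Proof.
move=> ivI [p [q pq]] x y /= [Ix hx] [Iy hy] z xzy.
have Iz : I z := ivI _ _ Ix Iy _ xzy.
split => //; rewrite !pq// in hx hy *; case/andP: xzy => xz zy.
have [<-//|zx] := eqVneq x z; have [->//|yz] := eqVneq z y.
have {xz zx}xz : x < z by rewrite lt_neqAle zx.
have {zy yz}zy : z < y by rewrite lt_neqAle yz.
case: c hx hy => hx hy; first by nra.
apply/negbTE; move/negbT: hx; move/negbT: hy; rewrite -!ltNge => hx hy.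
by nra.
Qed.

(* On a cell where the three comparisons are decided, [tent w] is one of its
   three affine branches. *)
Lemma affine_cover_tent (J : finType) A f w : affine_cover J A f ->
  affine_cover (J * bool * bool * bool)%type A (tent w \o f).
Proof.
move=> [I [ivI disj cov aff]].
pose c1 x := w.1 * f x + 0 <= - w.2 * f x + w.2.
pose c2 x := 0 * f x + 0 <= w.1 * f x + 0.
pose c3 x := 0 * f x + 0 <= - w.2 * f x + w.2.
exists (fun i : J * bool * bool * bool => I i.1.1.1 `&` [set x | c1 x = i.1.1.2]
  `&` [set x | c2 x = i.1.2] `&` [set x | c3 x = i.2]); split.
- move=> [[[i b1] b2] b3] /=.
  do 3?[apply: affine_le_interval => //];
    by apply: affine_on_sub (aff i) => x; rewrite /= => -[] //= [].
- move=> [[[i b1] b2] b3] [[[j b4] b5] b6] _ _ /=.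
  move=> [x [[[[Ii <-] <-] <-] [[[Ij <-] <-] <-]]].
  by rewrite (disj i j)//; exists x.
- rewrite -cov; apply/seteqP; split => [x [i _ [[[Ix _] _] _]]|x [i _ Ix]].
    by exists i.1.1.1.
  by exists (i, c1 x, c2 x, c3 x).
- move=> [[[i b1] b2] b3]; have [p [q pq]] := aff i.
  have maxE u v : Num.max 0 (Num.min u v) =
      (if u <= v then if 0 <= u then u else 0 else if 0 <= v then v else 0) :> R.
    by rewrite minEle maxEle; case: (u <= v).
  exists (if b1 then (if b2 then w.1 * p else 0) else (if b3 then - w.2 * p else 0)),
    (if b1 then (if b2 then w.1 * q else 0) else (if b3 then w.2 * (1 - q) else 0)).
  move=> x [[[/= Ix]]]; rewrite /c1 /c2 /c3 !mul0r !addr0 => h1 h2 h3.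
  rewrite /tent /= (_ : w.2 * (1 - f x) = - w.2 * f x + w.2); last by ring.
  rewrite maxE h1 h2 h3 pq//; case: b1 b2 b3 {h1 h2 h3} => [] [] [] /=; ring.
Qed.

Lemma tent_continuous w : continuous (tent w).
Proof.
move=> x; rewrite /tent.
apply: (@continuous_max R R (cst 0)
  (fun y : R => Num.min (w.1 * y) (w.2 * (1 - y)) : R^o)).
  exact: cvg_cst.
apply: (@continuous_min R R (fun y => w.1 * y : R^o) (fun y : R => w.2 * (1 - y) : R^o)).
  apply: cvgM; [exact: cvg_cst|exact: cvg_id].
apply: cvgM; first exact: cvg_cst.
by apply: cvgB; [exact: cvg_cst|exact: cvg_id].
Qed.


Lemma tent_iter_continuous (u : nat -> param R) n : continuous (tent_iter u n).
Proof.
elim: n => [|n ih] x /=; first exact: cvg_id.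
by apply: continuous_comp; [exact: ih|exact: tent_continuous].
Qed.

Lemma tent_iter_partition (u : nat -> param R) n :
  exists k, affine_partition (tent_iter u n) k.
Proof.
suff [J /affine_cover_partition[k _ h]] :
    exists J : finType, affine_cover J `[0, 1]%classic (tent_iter u n).
  by exists k.
elim: n => [|n [J ih]]; last by eexists; exact: (affine_cover_tent (u n) ih).
exists 'I_1; apply: affine_cover_affine; first exact: interval_is_interval.
by exists 1, 0 => x _ /=; rewrite mul1r addr0.
Qed.

Lemma num_pieces_min f : (exists k, affine_partition f k) ->
  affine_partition f (num_pieces f) /\
  forall j, affine_partition f j -> (num_pieces f <= j)%N.
Proof.
move=> [k0 pk0].
have ex : exists j, `[< affine_partition f j >] by exists k0; apply/asboolP.
have := @xgetPex _ 0%N [set k | affine_partition f k /\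
                    forall j, affine_partition f j -> (k <= j)%N]; apply.
case: (ex_minnP ex) => j /asboolP pj minj; exists j; split => // i pi.
exact/minj/asboolP.
Qed.

Lemma lt_num_pieces f k : continuous f -> (exists k0, affine_partition f k0) ->
  (k < num_pieces f)%N <-> exists2 X, size X = k & off_chain f 0 X.
Proof.
move=> cf /num_pieces_min[pN minN].
split => [kN|[X <- ch]]; last first.
  by apply: (off_chain_size (q := 0) pN); rewrite rmorph0 ?lexx ?ler01.
apply: (off_chain_exists (b := true)) => // cov.
have [j jk /minN Nj] := affine_cover_partition cov.
by have := leq_trans Nj jk; rewrite card_ord leqNgt kN.
Qed.

End TentPieces.

(** * Measurability *)

Section Measurability.
Context {R : realType} d (T : measurableType d).

Lemma measurable_neq0 (g : T -> R) : measurable_fun setT g ->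
  measurable [set t | g t != 0].
Proof.
move=> mg; rewrite (_ : mkset _ = setT `&` g @^-1` (~` [set 0])).
  by apply: mg => //; apply: measurableC.
by rewrite setTI; apply/seteqP; split => t /eqP.
Qed.

Variable F : T -> R -> R.
Hypotheses (cF : forall t, continuous (F t))
  (mF : forall x, measurable_fun setT (F^~ x)).

Lemma off_chord_rat f (x y : R) : continuous f -> off_chord f x y ->
  exists2 q : rat, x < ratr q < y &
    f (ratr q) * (y - x) != f x * (y - ratr q) + f y * (ratr q - x).
Proof.
move=> cf [s /andP[xs sy] off].
pose g z := f z * (y - x) - (f x * (y - z) + f y * (z - x)).
have cg : continuous g.
  move=> z; rewrite /g; apply: cvgB; last apply: cvgD.
  - by apply: cvgM; [exact: cf|exact: cvg_cst].
  - apply: cvgM; [exact: cvg_cst|apply: cvgB; [exact: cvg_cst|exact: cvg_id]].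
  - apply: cvgM; [exact: cvg_cst|apply: cvgB; [exact: cvg_id|exact: cvg_cst]].
have g0 : g s != 0 by rewrite /g subr_eq0.
have [e /= e0 eP] := cvgr_neq0 _ (cg s) g0.
have : s < Num.min y (s + e) by rewrite lt_min sy ltrDl e0.
move=> /rat_in_itvoo[q]; rewrite in_itv/= lt_min => /andP[sq /andP[qy qe]].
exists q; first by rewrite qy andbT (lt_trans xs).
rewrite -subr_eq0; apply: eP => /=; rewrite distrC ger0_norm ?subr_ge0 1?ltW//.
by rewrite ltrBlDr addrC.
Qed.

Lemma measurable_off_chord (x y : R) : measurable [set t | off_chord (F t) x y].
Proof.
rewrite (_ : mkset _ = \bigcup_(q : rat) [set t | x < ratr q < y /\
    F t (ratr q) * (y - x) - (F t x * (y - ratr q) + F t y * (ratr q - x)) != 0]).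
  apply: bigcupT_measurable_rat => q.
  have [xqy|nxqy] := boolP (x < ratr q < y); last first.
    by rewrite (_ : mkset _ = set0)//; apply/seteqP; split => t // [].
  rewrite (_ : mkset _ = [set t | F t (ratr q) * (y - x) -
    (F t x * (y - ratr q) + F t y * (ratr q - x)) != 0]).
    apply: measurable_neq0; apply: measurable_funB; last apply: measurable_funD;
    by apply: measurable_funM => //; exact: mF.
  by apply/seteqP; split => t // [].
apply/seteqP; split => t.
  by move=> /(off_chord_rat (@cF t))[q xqy off]; exists q => //; split; rewrite ?subr_eq0.
by move=> [q _ [xqy]]; rewrite subr_eq0 => off; exists (ratr q).
Qed.

Lemma measurable_off_chain (x : R) X : measurable [set t | off_chain (F t) x X].
Proof.
elim: X x => [|q X ih] x.
  by rewrite (_ : mkset _ = setT)//; apply/seteqP; split.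
have [q1|q1] := boolP ((ratr q : R) <= 1); last first.
  by rewrite (_ : mkset _ = set0)//; apply/seteqP; split => t //= -[_ h]; rewrite h in q1.
rewrite (_ : mkset _ = [set t | off_chord (F t) x (ratr q)] `&`
  [set t | off_chain (F t) (ratr q) X]).
  by apply: measurableI => //; exact: measurable_off_chord.
by apply/seteqP; split => t //= [].
Qed.

Hypothesis pF : forall t, exists k, affine_partition (F t) k.

Lemma measurable_lt_num_pieces k : measurable [set t | (k < num_pieces (F t))%N].
Proof.
rewrite (_ : mkset _ = \bigcup_(X : seq rat)
    [set t | size X = k /\ off_chain (F t) 0 X]).
  apply: countable_bigcupT_measurable => // X.
  have [<-|Xk] := eqVneq (size X) k; last first.
    by rewrite (_ : mkset _ = set0)//; apply/seteqP; split => t // [] /eqP;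
      rewrite (negbTE Xk).
  rewrite (_ : mkset _ = [set t | off_chain (F t) 0 X]).
    exact: measurable_off_chain.
  by apply/seteqP; split => t // [].
apply/seteqP; split => t /=.
  by move=> /(lt_num_pieces _ (@cF t) (pF t))[X]; exists X.
by move=> [X _ [? ?]]; apply/(lt_num_pieces _ (@cF t) (pF t)); exists X.
Qed.

Lemma measurable_num_pieces (B : set nat) : measurable [set t | B (num_pieces (F t))].
Proof.
rewrite (_ : mkset _ = \bigcup_(k in B) [set t | num_pieces (F t) = k]).
  apply: bigcup_measurable => k _.
  rewrite (_ : mkset _ = ~` [set t | (k < num_pieces (F t))%N] `&`
    [set t | (k <= num_pieces (F t))%N]).
    apply: measurableI; first by apply: measurableC; exact: measurable_lt_num_pieces.
    case: k => [|k]; last exact: measurable_lt_num_pieces.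
    by rewrite (_ : mkset _ = setT)//; apply/seteqP; split.
  apply/seteqP; split => t /=; first by move=> ->; rewrite ltnn.
  by move=> [/negP]; rewrite -leqNgt => h1 h2; apply/eqP; rewrite eqn_leq h1.
by apply/seteqP; split => t /=; [exists (num_pieces (F t))|move=> [k Bk ->]].
Qed.

End Measurability.

Section MeasurableTent.
Context {R : realType} d (T : measurableType d).

Lemma measurable_tent_iter (u : nat -> T -> param R) n x :
  (forall i, measurable_fun setT (u i)) ->
  measurable_fun setT (fun t => tent_iter (fun i => u i t) n x : measurableTypeR R).
Proof.
move=> mu; elim: n => [|n ih] /=; first exact: measurable_cst.
have m1 : measurable_fun setT (fun t => (u n t).1) by apply: measurableT_comp.
have m2 : measurable_fun setT (fun t => (u n t).2) by apply: measurableT_comp.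
rewrite /tent; apply: measurable_maxr; first exact: measurable_cst.
apply: measurable_minr; first exact: measurable_funM.
by apply: measurable_funM => //; apply: measurable_funB => //; exact: measurable_cst.
Qed.

Lemma measurable_tent_h : measurable_fun setT (@tent_h R : param R -> measurableTypeR R).
Proof.
pose s (w : param R) : R := w.1 + w.2.
rewrite (_ : tent_h = fun w => w.1 * w.2 * (s w * (s w ^+ 2) `^ (- 1))); last first.
  apply/funext => w; rewrite /tent_h /s powR_inv1 ?sqr_ge0//; congr (_ * _).
  have [->|s0] := eqVneq (w.1 + w.2) 0; first by rewrite invr0 mul0r.
  by rewrite expr2 invfM mulrA mulfV ?mul1r.
have ms : measurable_fun setT (s : param R -> measurableTypeR R).
  by apply: measurable_funD; [exact: measurable_fst|exact: measurable_snd].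
apply: measurable_funM.
  by apply: measurable_funM; [exact: measurable_fst|exact: measurable_snd].
apply: measurable_funM => //.
apply: (measurableT_comp (f := fun x : R => x `^ (- 1))); first exact: measurable_powR.
exact: measurable_funX.
Qed.

Lemma measurable_le_cst (g : T -> R) c : measurable_fun setT g ->
  measurable [set t | g t <= c].
Proof.
move=> mg; rewrite (_ : mkset _ = setT `&` g @^-1` `]-oo, c]%classic).
  by apply: mg => //; exact: measurable_itv.
by rewrite setTI; apply/seteqP; split => t /=; rewrite in_itv.
Qed.

Lemma measurable_lt_cst (g : T -> R) c : measurable_fun setT g ->
  measurable [set t | c < g t].
Proof.
move=> mg; rewrite (_ : mkset _ = ~` [set t | g t <= c]).
  by apply: measurableC; exact: measurable_le_cst.
by apply/seteqP; split => t /=; rewrite ltNge => /negP.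
Qed.

End MeasurableTent.

Section MeasurableParam.
Context {R : realType}.

Lemma measurable_kappa (eps : R) m a : measurable [set w : param R | kappa eps m w = a].
Proof.
pose D (b : {ffun 'I_m.+1 -> bool}) : set (param R) :=
  \bigcap_(i in [set: 'I_m.+1]) [set w | (tent_eta w <= rthr eps i) = b i].
have meta i : measurable [set w : param R | tent_eta w <= rthr eps i].
  apply: measurable_le_cst; apply: measurable_funB; first exact: measurable_cst.
  exact: measurable_tent_h.
have mD b : measurable (D b).
  apply: fin_bigcap_measurable => // i _.
  case: (b i); first exact: meta.
  rewrite (_ : mkset _ = ~` [set w : param R | tent_eta w <= rthr eps i]).
    exact: measurableC.
  by apply/seteqP; split => w /=; [move=> ->|move=> /negP/negbTE].
pose val (b : {ffun 'I_m.+1 -> bool}) : alphabet m :=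
  if b ord0 then Some [arg max_(l > ord0 | b l) l]%N else None.
have kE b w : D b w -> kappa eps m w = val b.
  move=> Dw; rewrite /kappa /val -(Dw ord0)//; case: ifP => // _; congr Some.
  rewrite /arg_max; congr odflt; apply: eq_pick => i /=.
  rewrite -(Dw i)//; congr andb; apply: eq_forallb => j; by rewrite -(Dw j).
rewrite (_ : mkset _ = \bigcup_(b in [set b | val b = a]) D b).
  by apply: fin_bigcup_measurable => // b _.
apply/seteqP; split => w /=; last by move=> [b /= <-] /kE.
pose b := [ffun i : 'I_m.+1 => tent_eta w <= rthr eps i].
have Dw : D b w by move=> i _ /=; rewrite ffunE.
by move=> <-; exists b => //=; rewrite (kE _ _ Dw).
Qed.

Lemma measurable_tent_dom (eps : R) : measurable (tent_dom eps).
Proof.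
have m1 := @measurable_fst _ _ (measurableTypeR R) (measurableTypeR R).
have m2 := @measurable_snd _ _ (measurableTypeR R) (measurableTypeR R).
rewrite (_ : tent_dom eps = [set w : param R | 0 < w.1] `&` [set w | 0 < w.2] `&`
  [set w : param R | `|w.1 - 2| <= eps] `&` [set w | `|w.2 - 2| <= eps] `&`
  [set w | tent_h w <= 1]); last first.
  by apply/seteqP; split => w; [move=> []|move=> [[[[]]]]].
do 4?apply: measurableI.
- exact: measurable_lt_cst.
- exact: measurable_lt_cst.
- apply: measurable_le_cst; apply: measurableT_comp => //.
  by apply: measurable_funB => //; exact: measurable_cst.
- apply: measurable_le_cst; apply: measurableT_comp => //.
  by apply: measurable_funB => //; exact: measurable_cst.
- by apply: measurable_le_cst; exact: measurable_tent_h.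
Qed.

End MeasurableParam.

(** * Laps *)

Section TentBounds.
Context {R : realType} (eps : R).
Hypothesis eps01 : 0 < eps < 1.
Implicit Types (w : param R).

Lemma Kcst_gt0 : 0 < Kcst eps.
Proof. by rewrite /Kcst; case/andP: eps01 => ? ?; lra. Qed.

Lemma rthr_gt0 i : 0 < rthr eps i.
Proof.
rewrite /rthr mulr_gt0 ?invr_gt0 ?exprn_gt0 ?Kcst_gt0// deltaE//.
by case/andP: eps01 => ? ?; lra.
Qed.

Lemma rthrS i : Kcst eps * rthr eps i.+1 = rthr eps i.
Proof.
rewrite /rthr exprS invfM mulrCA [X in _ * X]mulrA mulfV ?mul1r//.
by rewrite gt_eqF ?Kcst_gt0.
Qed.

Lemma rthr_le i : rthr eps i <= (2 - eps) / 8.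
Proof.
elim: i => [|i ih]; first by rewrite /rthr expr0 invr1 mulr1 deltaE.
apply: le_trans ih; rewrite -(rthrS i) ler_peMl ?(ltW (rthr_gt0 _))//.
by rewrite /Kcst; case/andP: eps01 => ? ?; lra.
Qed.

Lemma tent_low w x i : tent_dom eps w -> x <= rthr eps i.+1 ->
  tent w x <= rthr eps i.
Proof.
move=> [a0 b0 + _ _] xi; rewrite ler_norml => /andP[_ aK].
rewrite /tent ge_max (ltW (rthr_gt0 _))/= ge_min; apply/orP; left.
have r0 := rthr_gt0 i.+1.
apply: (@le_trans _ _ (w.1 * rthr eps i.+1)); first by rewrite ler_pM2l.
by rewrite -(rthrS i) ler_pM2r// /Kcst; lra.
Qed.

Lemma tent_high w x i : tent_dom eps w -> 1 - rthr eps i.+1 <= x ->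
  tent w x <= rthr eps i.
Proof.
move=> [a0 b0 _ + _] xi; rewrite ler_norml => /andP[_ aK].
rewrite /tent ge_max (ltW (rthr_gt0 _))/= ge_min; apply/orP; right.
have r0 := rthr_gt0 i.+1.
apply: (@le_trans _ _ (w.2 * rthr eps i.+1)).
  by rewrite ler_pM2l// lerBlDr -lerBlDl.
by rewrite -(rthrS i) ler_pM2r// /Kcst; lra.
Qed.

Lemma tent_c_bounds w i j : tent_dom eps w ->
  rthr eps i < tent_c w < 1 - rthr eps j.
Proof.
move=> [a0 b0 + + _]; rewrite !ler_norml => /andP[a1 a2] /andP[b1 b2].
have s0 : 0 < w.1 + w.2 by rewrite addr_gt0.
have ri := rthr_le i; have rj := rthr_le j; case/andP: eps01 => e0 e1.
rewrite /tent_c; apply/andP; split.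
  by apply: (le_lt_trans ri); rewrite ltr_pdivlMr//; nra.
have : w.2 / (w.1 + w.2) < 1 - (2 - eps) / 8 by rewrite ltr_pdivrMr//; nra.
by lra.
Qed.

Lemma tent_tent_c w : tent_dom eps w -> tent w (tent_c w) = tent_h w.
Proof.
move=> [a0 b0 _ _ _]; have s0 : w.1 + w.2 != 0 by rewrite gt_eqF ?addr_gt0.
rewrite /tent /tent_c /tent_h.
have -> : w.1 * (w.2 / (w.1 + w.2)) = w.1 * w.2 / (w.1 + w.2) by rewrite mulrA.
have -> : w.2 * (1 - w.2 / (w.1 + w.2)) = w.1 * w.2 / (w.1 + w.2) by field.
by rewrite minxx; apply/max_idPr; rewrite divr_ge0 ?mulr_ge0 ?addr_ge0 ?ltW.
Qed.

Lemma kappa_eta m w (l : 'I_m.+1) : kappa eps m w = Some l ->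
  1 - rthr eps l <= tent_h w.
Proof.
rewrite /kappa; case: ifP => // h0 [<-]; case: arg_maxnP => //= i + _.
by rewrite /tent_eta lerBlDr -lerBlDl.
Qed.

End TentBounds.

Section Transfer.
Context {R : realType} (m : nat).
Implicit Types (v u : @vec R m) (a : alphabet m).

Lemma transferD a u v : transfer a (u + v) = transfer a u + transfer a v.
Proof.
case: a => [l|] /=; last by rewrite addr0.
by rewrite -big_split; apply: eq_bigr => s _; rewrite ffunE scalerDl.
Qed.

Lemma transferZ a (c : R) v : transfer a (c *: v) = c *: transfer a v.
Proof.
case: a => [l|] /=; last by rewrite scaler0.
by rewrite scaler_sumr; apply: eq_bigr => s _; rewrite ffunE scalerA.
Qed.

Lemma transfer0 a : transfer a (0 : @vec R m) = 0.
Proof. by rewrite -(scale0r (0 : @vec R m)) transferZ !scale0r. Qed.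

Lemma transfer_wordZ (w : seq (alphabet m)) (c : R) v :
  transfer_word w (c *: v) = c *: transfer_word w v.
Proof. by elim: w v => //= a w ih v; rewrite transferZ ih. Qed.

Definition sumF v : R := \sum_(i < m) (v (sstate i) : R).

Lemma Gam_sumF (w : seq (alphabet m)) : Gam w = sumF (transfer_word w (@estar R m)).
Proof.
rewrite /Gam mxE; apply: eq_bigr => i _.
by rewrite /oneF /projF !mxE mul1r.
Qed.

Lemma sumFD u v : sumF (u + v) = sumF u + sumF v.
Proof. by rewrite -big_split; apply: eq_bigr => i _; rewrite ffunE. Qed.

Lemma sumFZ (c : R) v : sumF (c *: v) = c * sumF v.
Proof. by rewrite /sumF mulr_sumr; apply: eq_bigr => i _; rewrite ffunE. Qed.

Lemma sumF0 : sumF 0 = 0.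
Proof. by rewrite /sumF big1// => i _; rewrite ffunE. Qed.

Lemma sumF_ebasis (s : Sigma m) :
  sumF (ebasis s) = ((s.2 == ord_max) && (s.1 < m)%N)%:R.
Proof.
case: s => i j /=; rewrite /sumF.
have [->|jm] := eqVneq j ord_max; last first.
  rewrite big1 // => k _; rewrite ffunE /sstate xpair_eqE.
  by rewrite [ord_max == j]eq_sym (negbTE jm) andbF.
rewrite /=; case: ltnP => im /=.
  rewrite (bigD1 (Ordinal im)) //= big1 ?addr0.
    by rewrite ffunE /sstate (_ : widen_ord _ _ = i) ?eqxx//; exact: val_inj.
  move=> k ki; rewrite ffunE /sstate xpair_eqE; case: eqP => // ke.
  by case/eqP: ki; apply: val_inj; rewrite /= -ke.
rewrite big1 // => k _; rewrite ffunE /sstate xpair_eqE; case: eqP => // ke.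
by move: im; rewrite -ke /= leqNgt ltn_ord.
Qed.

Lemma sumF_estar : (0 < m)%N -> sumF (@estar R m) = 1.
Proof.
move=> m0; rewrite sumF_ebasis eqxx /= inordK; first by rewrite prednK ?leqnn.
by rewrite prednK // ltnW.
Qed.

End Transfer.

Section Laps.
Context {R : realType} (eps : R) (m : nat).
Hypothesis eps01 : 0 < eps < 1.
Implicit Types (f : R -> R) (p q x y z : R) (s : Sigma m) (v : @vec R m).

Definition ends f x y s : Prop := f x <= rthr eps s.1 /\ 1 - rthr eps s.2 <= f y.

(* [laps f p q v]: the interval [p, q] contains non-overlapping intervals with
   endpoints in the low and high zones of [f], [v s] of them in state [s]. *)
Inductive laps f : R -> R -> @vec R m -> Prop :=
| laps_nil p q : p <= q -> laps f p q 0
| laps_one p q s : p < q -> ends f p q s \/ ends f q p s -> laps f p q (ebasis s)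
| laps_cat p z q u v : laps f p z u -> laps f z q v -> laps f p q (u + v).

Lemma laps_le f p q v : laps f p q v -> p <= q.
Proof.
elim=> // [p' q' s /ltW //|p' z q' u v' _ pz _ zq]; exact: le_trans zq.
Qed.

Lemma laps_if (c : bool) f x y s : x < y ->
  (c -> ends f x y s \/ ends f y x s) -> laps f x y (if c then ebasis s else 0).
Proof. by case: c => xy h; [apply: laps_one => //; exact: h|apply/laps_nil/ltW]. Qed.

Lemma ends_step f w x z i j (a : 'I_m.+1) : tent_dom eps w ->
  kappa eps m w = Some a -> f z = tent_c w -> (0 < i)%N ->
  f x <= rthr eps i \/ 1 - rthr eps i <= f x ->
  (i <= m)%N -> j = (inord i.-1, a) -> ends (tent w \o f) x z j.
Proof.
move=> wd ka fz i0 hx im ->; split => /=; last first.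
  by rewrite fz (tent_tent_c wd); exact: kappa_eta ka.
rewrite inordK; last by rewrite (leq_ltn_trans (leq_pred _)).
rewrite -(prednK i0) in hx.
by case: hx => hx; [exact: tent_low|exact: tent_high].
Qed.

Lemma IVT_strict f (p q c : R) : continuous f -> p < q ->
  (f p < c < f q) || (f q < c < f p) -> exists2 z, p < z < q & f z = c.
Proof.
move=> cf pq h.
have [||z] := @IVT R f p q c (ltW pq).
- exact: continuous_subspaceT.
- by rewrite ge_min le_max; case/orP: h => /andP[/ltW -> /ltW ->]; rewrite ?orbT.
rewrite in_itv /= => /andP[pz zq] fz; exists z => //.
have np : z != p by apply: contraL h => /eqP e; rewrite -fz e ltxx andbF.
have nq : z != q by apply: contraL h => /eqP e; rewrite -fz e ltxx andbF.
by rewrite !lt_neqAle pz zq eq_sym np nq.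
Qed.

Lemma ends_turn f w p q s : continuous f -> tent_dom eps w -> p < q ->
  ends f p q s \/ ends f q p s -> exists2 z, p < z < q & f z = tent_c w.
Proof.
move=> cf wd pq h; apply: IVT_strict => //.
have /andP[c1 c2] := tent_c_bounds eps01 s.1 s.2 wd.
case: h => -[l u]; rewrite (le_lt_trans l c1) (lt_le_trans c2 u) //.
by rewrite orbT.
Qed.

Lemma laps_transfer f w p q v : continuous f -> tent_dom eps w ->
  laps f p q v -> laps (tent w \o f) p q (transfer (kappa eps m w) v).
Proof.
move=> cf wd; elim=> {p q v} [p q pq|p q s pq h|p z q u v _ ihu _ ihv].
- by rewrite transfer0; exact: laps_nil.
- case ka: (kappa eps m w) => [a|]; last exact/laps_nil/ltW.
  have [z /andP[pz zq] fz] := ends_turn cf wd pq h.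
  rewrite transfer_ebasis /transfer_basis.
  have sm k : (k < m.+1)%N -> (k <= m)%N by rewrite ltnS.
  case: h => -[l u]; last rewrite addrC.
  + apply: (@laps_cat _ _ z); apply: laps_if => // i0; [left|right].
    * by apply: (ends_step wd ka fz i0 _ (sm _ (ltn_ord _)) erefl); left.
    * by apply: (ends_step wd ka fz i0 _ (sm _ (ltn_ord _)) erefl); right.
  + apply: (@laps_cat _ _ z); apply: laps_if => // i0; [left|right].
    * by apply: (ends_step wd ka fz i0 _ (sm _ (ltn_ord _)) erefl); right.
    * by apply: (ends_step wd ka fz i0 _ (sm _ (ltn_ord _)) erefl); left.
- by rewrite transferD; apply: laps_cat ihu ihv.
Qed.

(* After the letter [m], the half of a lap in state [s_i] that starts at the
   high end is in state [estar], whatever [i] is. *)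
Lemma laps_bridge f w p q v : (0 < m)%N -> continuous f -> tent_dom eps w ->
  kappa eps m w = Some ord_max ->
  laps f p q v -> laps (tent w \o f) p q (sumF v *: estar m).
Proof.
move=> m0 cf wd ka; elim=> {p q v} [p q pq|p q s pq h|p z q u v _ ihu _ ihv].
- by rewrite sumF0 scale0r; exact: laps_nil.
- rewrite sumF_ebasis; case: eqP => [sm|_] /=; last first.
    by rewrite scale0r; exact/laps_nil/ltW.
  case: (s.1 < m)%N; last by rewrite scale0r; exact/laps_nil/ltW.
  have [z /andP[pz zq] fz] := ends_turn cf wd pq h.
  rewrite scale1r; case: h => -[_ u]; rewrite sm in u.
  + rewrite -[estar m]add0r; apply: (@laps_cat _ _ z); first exact/laps_nil/ltW.
    apply: laps_one => //; right.
    by apply: (ends_step wd ka fz m0 _ _ erefl) => //; right.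
  + rewrite -[estar m]addr0; apply: (@laps_cat _ _ z); last exact/laps_nil/ltW.
    apply: laps_one => //; left.
    by apply: (ends_step wd ka fz m0 _ _ erefl) => //; right.
- by rewrite sumFD scalerDl; apply: laps_cat ihu ihv.
Qed.

Lemma laps_word (g : nat -> param R) n (w : seq (alphabet m)) p q v :
  (forall i, (i < size w)%N -> tent_dom eps (g (n + i)%N)) ->
  (forall i, (i < size w)%N -> kappa eps m (g (n + i)%N) = nth None w i) ->
  laps (tent_iter g n) p q v ->
  laps (tent_iter g (n + size w)) p q (transfer_word w v).
Proof.
elim: w n v => [|a w ih] n v gd gk lv /=; first by rewrite addn0.
rewrite addnS -addSn; apply: ih => [i iw|i iw|].
- by rewrite addSnnS; exact: gd.
- by rewrite addSnnS; exact: (gk i.+1).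
- have := gk 0%N isT; rewrite addn0 /= => <-; apply: laps_transfer => //.
    exact: tent_iter_continuous.
  by have := gd 0%N isT; rewrite addn0.
Qed.

Definition bridged (ws : seq (seq (alphabet m))) : seq (alphabet m) :=
  flatten [seq Some ord_max :: w | w <- ws].

Lemma laps_bridged (g : nat -> param R) (ws : seq (seq (alphabet m))) n p q v :
  (0 < m)%N ->
  (forall i, (i < size (bridged ws))%N -> tent_dom eps (g (n + i)%N)) ->
  (forall i, (i < size (bridged ws))%N ->
    kappa eps m (g (n + i)%N) = nth None (bridged ws) i) ->
  laps (tent_iter g n) p q v ->
  exists2 u, laps (tent_iter g (n + size (bridged ws))) p q u &
    sumF u = sumF v * \prod_(w <- ws) Gam w.
Proof.
move=> m0; elim: ws n v => [|w ws ih] n v gd gk lv.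
  by exists v; rewrite ?addn0// big_nil mulr1.
have szE : size (bridged (w :: ws)) = (size w + size (bridged ws)).+1.
  by rewrite /= size_cat.
have l1 : laps (tent_iter g n.+1) p q (sumF v *: estar m).
  apply: laps_bridge => //; first exact: tent_iter_continuous.
    by have := gd 0%N; rewrite szE addn0; apply.
  by have := gk 0%N; rewrite szE addn0; apply.
have l2 : laps (tent_iter g (n.+1 + size w)) p q (transfer_word w (sumF v *: estar m)).
  apply: laps_word l1 => i iw; rewrite addSnnS.
    by apply: gd; rewrite szE ltnS ltn_addr.
  by rewrite gk ?szE ?ltnS ?ltn_addr//= nth_cat iw.
have [||u lu uE] := ih _ _ _ _ l2.
- by move=> i iw; rewrite !addSn -addnA -addnS; apply: gd; rewrite szE ltnS ltn_add2l.
- move=> i iw; rewrite !addSn -addnA -addnS gk ?szE ?ltnS ?ltn_add2l//.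
  by rewrite /= nth_cat ltnNge leq_addr /= addKn.
exists u; first by rewrite szE addnS -addSn addnA.
by rewrite uE transfer_wordZ sumFZ -Gam_sumF big_cons mulrA.
Qed.

(* Each lap contributes a point at height 1/2, and two such points are separated
   by an end of a lap, where the height is not 1/2. *)
Lemma laps_off_chord f p q v : continuous f -> laps f p q v ->
  exists X : seq R, [/\ (size X)%:R = sumF v,
    forall x, x \in X -> [/\ f x = 2^-1, p <= x <= q,
      exists2 y, p <= y < x & f y != 2^-1 & exists2 y, x < y <= q & f y != 2^-1]
    & pairwise (fun x y => `[< off_chord f x y >]) X].
Proof.
move=> cf; elim=> {p q v}
  [p q pq|p q s pq h|p z q u v lu [X [sX hX pX]] lv [Y [sY hY pY]]].
- by exists [::]; rewrite sumF0.
- rewrite sumF_ebasis; case: (_ && _); last by exists [::].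
  have h' : (f p < 2^-1 < f q) || (f q < 2^-1 < f p).
    have r1 := rthr_le eps01 s.1; have r2 := rthr_le eps01 s.2.
    by case/andP: eps01 => e0 e1; case: h => -[l k]; apply/orP; [left|right]; lra.
  have [z /andP[pz zq] fz] := IVT_strict cf pq h'.
  exists [:: z]; split => // x; rewrite inE => /eqP ->; split => //.
  + by rewrite !ltW.
  + exists p; first by rewrite lexx.
    by case/orP: h' => /andP[? ?]; [rewrite lt_eqF|rewrite gt_eqF].
  + exists q; first by rewrite lexx andbT.
    by case/orP: h' => /andP[? ?]; [rewrite gt_eqF|rewrite lt_eqF].
- have pz := laps_le lu; have zq := laps_le lv.
  exists (X ++ Y); split.
  + by rewrite size_cat natrD sX sY sumFD.
  + move=> x; rewrite mem_cat => /orP[/hX|/hY] [fx /andP[xp xq]]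
      [y /andP[y1 y2] yf] [y' /andP[y3 y4] yf']; split => //.
    * by rewrite xp (le_trans xq).
    * by exists y => //; rewrite y1.
    * by exists y' => //; rewrite y3 (le_trans y4).
    * by rewrite xq (le_trans pz).
    * by exists y => //; rewrite y2 (le_trans pz).
    * by exists y' => //; rewrite y3.
  + rewrite pairwise_cat pX pY !andbT; apply/allrelP => x y.
    move=> /hX[fx _ _ [s /andP[xs sz] fs]] /hY[fy /andP[zy _] _ _]; apply/asboolP.
    have sy : s < y.
      rewrite lt_neqAle (le_trans sz zy) andbT; apply: contra fs => /eqP ->; exact/eqP.
    exists s; first by rewrite xs.
    rewrite fx fy -subr_eq0 (_ : _ - _ = (f s - 2^-1) * (y - x)); last by ring.
    by rewrite mulf_neq0// subr_eq0// gt_eqF// (lt_trans xs).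
Qed.

Lemma laps_num_pieces f v : continuous f -> (exists k, affine_partition f k) ->
  laps f 0 1 v -> sumF v <= (num_pieces f)%:R.
Proof.
move=> cf pf /(laps_off_chord cf)[X [<- hX pX]].
rewrite ler_nat; apply: size_off_chord_le pX; first exact: (num_pieces_min pf).1.
by move=> x /hX[].
Qed.

Lemma prod_Gam_le (g : nat -> param R) (ws : seq (seq (alphabet m))) :
  (0 < m)%N ->
  (forall i, (i < size (bridged ws))%N -> tent_dom eps (g i)) ->
  (forall i, (i < size (bridged ws))%N -> kappa eps m (g i) = nth None (bridged ws) i) ->
  \prod_(w <- ws) Gam w <= (num_pieces (tent_iter g (size (bridged ws))))%:R :> R.
Proof.
move=> m0 gd gk.
have l0 : laps (tent_iter g 0) 0 1 (estar m).
  apply: laps_one; first exact: ltr01.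
  by left; split => /=; [|rewrite lerBlDr lerDl]; exact/ltW/rthr_gt0.
have [u lu uE] := laps_bridged (n := 0) m0 gd gk l0.
rewrite (le_trans _ (laps_num_pieces _ _ lu)) //.
- by rewrite uE sumF_estar// mul1r.
- exact: tent_iter_continuous.
- exact: tent_iter_partition.
Qed.

End Laps.

(** * A lower bound of Cramer type on finite sets *)

Section Cramer.
Context {R : realType} (W : finType).
Implicit Types (nu q f : W -> R).

Definition prodw nu k (w : {ffun 'I_k -> W}) : R := \prod_i nu (w i).

Lemma sum_prodw nu k : \sum_w nu w = 1 -> \sum_(w : {ffun 'I_k -> W}) prodw nu w = 1.
Proof.
by move=> nu1; rewrite /prodw -(bigA_distr_bigA (fun _ => nu)) big1.
Qed.

Lemma sum_prodw_sqr nu f k : \sum_w nu w = 1 -> \sum_w nu w * f w = 0 ->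
  \sum_(w : {ffun 'I_k -> W}) prodw nu w * (\sum_i f (w i)) ^+ 2 =
  k%:R * \sum_w nu w * f w ^+ 2.
Proof.
move=> nu1 f0.
have E (w : {ffun 'I_k -> W}) : prodw nu w * (\sum_i f (w i)) ^+ 2 =
    \sum_i \sum_j \prod_l
      (nu (w l) * ((if l == i then f (w l) else 1) * (if l == j then f (w l) else 1))).
  rewrite expr2 big_distrlr mulr_sumr; apply: eq_bigr => i _.
  rewrite mulr_sumr; apply: eq_bigr => j _.
  rewrite big_split /=; congr (_ * _); rewrite big_split /=.
  by rewrite -!big_mkcond !big_pred1_eq.
under eq_bigr do rewrite E.
rewrite exchange_big /=.
transitivity (\sum_(i < k) \sum_w nu w * f w ^+ 2); last first.
  by rewrite sumr_const card_ord mulr_natl.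
apply: eq_bigr => i _; rewrite exchange_big /= (bigD1 i) //= [X in _ + X]big1 ?addr0.
  rewrite -(bigA_distr_bigA (fun l w => nu w * ((if l == i then f w else 1) *
    (if l == i then f w else 1)))) (bigD1 i) //= [X in _ * X]big1 ?mulr1.
    by apply: eq_bigr => w _; rewrite eqxx expr2.
  move=> l /negbTE->; rewrite -[RHS]nu1; apply: eq_bigr => w _; by rewrite !mulr1.
move=> j ji.
rewrite -(bigA_distr_bigA (fun l w => nu w * ((if l == i then f w else 1) *
    (if l == j then f w else 1)))) (bigD1 i) //=.
rewrite (_ : \sum_w _ = 0) ?mul0r// -[RHS]f0; apply: eq_bigr => w _.
by rewrite eqxx eq_sym (negbTE ji) mulr1.
Qed.

Lemma weak_law nu f (mean e : R) : is_pmf nu -> \sum_w nu w * f w = mean -> 0 < e ->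
  exists C : R, 0 <= C /\ forall k,
    k%:R * \sum_(w : {ffun 'I_k -> W} | k%:R * (mean + e) <= \sum_i f (w i))
      prodw nu w <= C.
Proof.
move=> [nu0 nu1] fm e0.
pose g w := f w - mean; pose V := \sum_w nu w * g w ^+ 2.
have g0 : \sum_w nu w * g w = 0.
  under eq_bigr do rewrite mulrBr; rewrite sumrB fm -mulr_suml nu1 mul1r.
  exact: subrr.
have V0 : 0 <= V by apply: sumr_ge0 => w _; rewrite mulr_ge0 ?sqr_ge0.
have pw0 k (w : {ffun 'I_k -> W}) : 0 <= prodw nu w by apply: prodr_ge0.
exists (V / e ^+ 2); split; first by rewrite divr_ge0// sqr_ge0.
case=> [|k]; first by rewrite mul0r divr_ge0// sqr_ge0.
have kp : 0 < (k.+1%:R : R) by rewrite ltr0n.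
set S := \sum_(w | _) _.
have main : (k.+1%:R * e) ^+ 2 * S <= k.+1%:R * V.
  rewrite -(sum_prodw_sqr k.+1 nu1 g0) mulr_sumr [leLHS]big_mkcond.
  apply: ler_sum => w _; case: ifP => [h|_]; last by rewrite mulr_ge0 ?sqr_ge0.
  rewrite mulrC ler_wpM2l// lerXn2r ?nnegrE //.
  - by rewrite mulr_ge0 ?ltW.
  - rewrite sumrB sumr_const card_ord subr_ge0 -mulr_natl (le_trans _ h)//.
    by rewrite ler_wpM2l ?ler0n// lerDl ltW.
  - by rewrite sumrB sumr_const card_ord lerBrDr -[mean *+ _]mulr_natl -mulrDr [e + _]addrC.
rewrite ler_pdivlMr ?exprn_gt0// -(ler_pM2l kp); apply: le_trans main.
by rewrite le_eqVlt; apply/orP; left; apply/eqP; ring.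
Qed.

(* Tilting the product law q^k to nu^k: on the words whose empirical mean of
   ln (nu/q) is at most H + e, the density costs exp (- k (H + e)), and nu^k
   gives these words probability close to one. *)
Lemma cramer_lower nu q g (G : {set W}) (y e : R) : is_pmf nu -> (forall w, 0 <= q w) ->
  (forall w, q w = 0 -> nu w = 0) -> \sum_(w in G) nu w = 1 ->
  y < \sum_(w in G) nu w * g w -> 0 < e ->
  exists k0, forall k, (k0 <= k)%N ->
    2^-1 * expR (- (k%:R * (\sum_w nu w * ln (nu w / q w) + e))) <=
    \sum_(w : {ffun 'I_k -> W} | [forall i, w i \in G] && (k%:R * y < \sum_i g (w i)))
       prodw q w.
Proof.
move=> nupmf q0 ac nuG yg e0; have [nu0 nu1] := nupmf.
set H := \sum_w _.
have nuGz w : w \notin G -> nu w = 0.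
  move=> wG; have : \sum_(v | v \notin G) nu v = 0.
    by move: nu1; rewrite (bigID (mem G)) /= nuG -[RHS]addr0 => /addrI.
  move/eqP; rewrite psumr_eq0 // => /allP /(_ w (mem_index_enum _)).
  by rewrite wG => /eqP.
have gE : \sum_w nu w * (- g w) = - \sum_(w in G) nu w * g w.
  rewrite -[RHS]sumrN (bigID (mem G)) /= [X in _ + X]big1 ?addr0.
    by apply: eq_bigr => w _; rewrite mulrN.
  by move=> w wG; rewrite nuGz // mul0r.
set M := \sum_(w in G) nu w * g w in yg gE.
have [C1 [C10 hC1]] := weak_law nupmf (erefl H) e0.
have yM : 0 < M - y by rewrite subr_gt0.
have [C2 [C20 hC2]] := weak_law nupmf gE yM.
pose k0 := (Num.truncn (2 * (C1 + C2))).+1.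
exists k0 => k k0k.
have kC : 2 * (C1 + C2) < k%:R.
  apply: (lt_le_trans (truncnS_gt _)); by rewrite ler_nat.
have kp : 0 < (k%:R : R) by apply: le_lt_trans kC; rewrite mulr_ge0 ?addr_ge0.
pose A1 := [pred w : {ffun 'I_k -> W} | k%:R * (H + e) <= \sum_i ln (nu (w i) / q (w i))].
pose A2 := [pred w : {ffun 'I_k -> W} | k%:R * (- M + (M - y)) <= \sum_i - g (w i)].
have {}hC1 := hC1 k; have {}hC2 := hC2 k.
rewrite -/A1 in hC1; rewrite -/A2 in hC2.
pose Z := [pred w : {ffun 'I_k -> W} | [forall i, nu (w i) != 0]].
have pw0 (w : {ffun 'I_k -> W}) : 0 <= prodw nu w by apply: prodr_ge0.
have half : 2^-1 <= \sum_(w | Z w && ~~ A1 w && ~~ A2 w) prodw nu w.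
  have tot : 1 <= \sum_(w | Z w && ~~ A1 w && ~~ A2 w) prodw nu w +
      (\sum_(w | A1 w) prodw nu w + \sum_(w | A2 w) prodw nu w).
    rewrite -[leLHS](sum_prodw k nu1) [X in _ <= X + _]big_mkcond
      [X in _ <= _ + (X + _)]big_mkcond [X in _ <= _ + (_ + X)]big_mkcond -!big_split /=.
    apply: ler_sum => w _.
    have [zw|] := boolP [forall i, nu (w i) != 0]; last first.
      rewrite negb_forall => /existsP[i]; rewrite negbK => /eqP zi.
      by rewrite /prodw (bigD1 i) //= zi mul0r; do 2?case: ifP; rewrite ?addr0.
    by case: (_ * (H + e) <= _); case: (_ * (- M + _) <= _) => /=;
      rewrite ?add0r ?addr0 ?lerDl.
  have b1 : \sum_(w | A1 w) prodw nu w <= C1 / k%:R by rewrite ler_pdivlMr // mulrC.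
  have b2 : \sum_(w | A2 w) prodw nu w <= C2 / k%:R by rewrite ler_pdivlMr // mulrC.
  have : (C1 + C2) / k%:R <= 2^-1 by rewrite ler_pdivrMr//; lra.
  rewrite mulrDl => b3; move: tot b1 b2 b3; lra.
apply: (@le_trans _ _ (\sum_(w | Z w && ~~ A1 w && ~~ A2 w)
    expR (- (k%:R * (H + e))) * prodw nu w)).
  by rewrite -mulr_sumr mulrC ler_wpM2l ?expR_ge0.
rewrite [leRHS]big_mkcond [leLHS]big_mkcond /=; apply: ler_sum => w _.
have qw0 : 0 <= prodw q w by apply: prodr_ge0.
case: ifP => [/andP[/andP[/forallP zw a1] a2]|_]; last by case: ifP.
have qw i : 0 < q (w i).
  by rewrite lt_neqAle q0 andbT eq_sym; apply: contra (zw i) => /eqP /ac ->.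
have nw i : 0 < nu (w i) by rewrite lt_neqAle nu0 andbT eq_sym.
rewrite ifT; last first.
  apply/andP; split; first by apply/forallP => i; apply: contraNT (zw i) => /nuGz ->.
  by move: a2; rewrite -ltNge sumrN addrA addNr add0r mulrN ltrN2.
have -> : prodw nu w = expR (\sum_i ln (nu (w i) / q (w i))) * prodw q w.
  rewrite expR_sum /prodw -big_split; apply: eq_bigr => i _ /=.
  by rewrite lnK ?posrE ?divr_gt0// divfK// gt_eqF.
rewrite mulrA -expRD ler_piMl// -[leRHS]expR0 ler_expR.
by rewrite addrC subr_le0; move: a1; rewrite /= -ltNge => /ltW.
Qed.

End Cramer.

(** * Words of coarse symbols *)

Section ProbabilityFacts.
Context {R : realType} d (T : measurableType d) (P : probability T R).

Lemma measure_disjoint_sum (I : eqType) (s : seq I) (F : I -> set T) :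
  uniq s -> (forall i, measurable (F i)) ->
  (forall i j t, F i t -> F j t -> i = j) ->
  P (\big[setU/set0]_(i <- s) F i) = (\sum_(i <- s) P (F i))%E.
Proof.
move=> us mF disj; elim: s us => [_|i s ih /= /andP[iNs us]].
  by rewrite !big_nil measure0.
rewrite !big_cons measureU//; first by congr (_ + _)%E; exact: ih.
  by apply: bigsetU_measurable => ? _; exact: mF.
apply/seteqP; split => // t [Fi].
rewrite big_seq_cond; elim/big_ind: _ => //.
  by move=> A B hA hB [/hA|/hB].
by move=> j /andP[js _] Fj; rewrite (disj _ _ _ Fi Fj) js in iNs.
Qed.

Lemma probability_setI1 (A B : set T) : measurable A -> measurable B ->
  P B = 1%E -> P (A `&` B) = P A.
Proof.
move=> mA mB PB.
have PCB : P (~` B) = 0%E by rewrite probability_setC// PB subee.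
rewrite -[in RHS](setIT A) -(setUv B) setIUr measureU0//.
- exact: measurableI.
- by apply: measurableI => //; exact: measurableC.
- apply/eqP; rewrite -measure_le0 -PCB le_measure ?inE//.
  + by apply: measurableI => //; exact: measurableC.
  + exact: measurableC.
Qed.

End ProbabilityFacts.

Lemma limn_einf_ge {R : realType} (u : nat -> \bar R) (c : \bar R) k0 :
  (forall k, (k0 <= k)%N -> (c <= u k)%E) -> (c <= limn_einf u)%E.
Proof.
move=> h; rewrite limn_einf_lim; apply: lime_ge; first exact: is_cvg_einfs.
near=> n; apply: le_ereal_inf_tmp => _ [k /= nk <-]; apply: h.
by apply: leq_trans nk; near: n; exists k0.
Unshelve. all: by end_near. Qed.

Section Words.
Context {R : realType} (eps : R) (eps01 : 0 < eps < 1)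
  (mu : probability (param R) R) (mu_supp : mu (tent_dom eps) = 1%E)
  (d : measure_display) (T : measurableType d) (P : probability T R)
  (omega : nat -> {RV P >-> param R}) (omega_iid : iid mu omega)
  (m : nat).

Let pi_m := kappa_law P eps m (omega 0%N).

(* The parameters are required to lie in the domain as well, at no cost in
   probability, so that the pathwise bounds hold on the whole event. *)
Definition word_event (s : seq (alphabet m)) : set T :=
  \bigcap_(i in [set` iota 0 (size s)])
    (omega i @^-1` ([set w | kappa eps m w = nth None s i] `&` tent_dom eps)).

Lemma measurable_word_event s : measurable (word_event s).
Proof.
apply: fin_bigcap_measurable; first exact: finite_seq.
move=> i _; rewrite -[X in measurable X]setTI.
apply: (measurable_funP (omega i)) => //; apply: measurableI.
  exact: measurable_kappa.
exact: measurable_tent_dom.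
Qed.

Lemma kappa_lawE a : (pi_m a)%:E = mu [set w | kappa eps m w = a].
Proof.
have [ident _] := omega_iid.
rewrite /pi_m /kappa_law -(ident 0%N); last exact: measurable_kappa.
rewrite fineK// fin_num_measure//.
rewrite -[mkset _]/(omega 0%N @^-1` [set w | kappa eps m w = a]).
by apply: measurable_funPTI; exact: measurable_kappa.
Qed.

Lemma word_event_prob s : P (word_event s) = (\prod_(a <- s) pi_m a)%:E.
Proof.
have [ident indep] := omega_iid.
have mA i : measurable ([set w | kappa eps m w = nth None s i] `&` tent_dom eps).
  by apply: measurableI; [exact: measurable_kappa|exact: measurable_tent_dom].
rewrite /word_event indep ?iota_uniq//.
have -> : (\prod_(a <- s) pi_m a)%:E = (\prod_(a <- s) (pi_m a)%:E)%E.
  by elim: s {mA} => [|a s ih]; rewrite ?big_nil // !big_cons -ih EFinM.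
rewrite [RHS](big_nth None) /index_iota subn0.
apply: eq_bigr => i _; rewrite kappa_lawE -(probability_setI1 _ _ mu_supp).
- exact: ident.
- exact: measurable_kappa.
- exact: measurable_tent_dom.
Qed.

Lemma word_event_nth s t i : word_event s t -> (i < size s)%N ->
  kappa eps m (omega i t) = nth None s i /\ tent_dom eps (omega i t).
Proof. by move=> h si; apply: h; rewrite /= mem_iota. Qed.

Lemma word_event_inj s s' t : size s = size s' ->
  word_event s t -> word_event s' t -> s = s'.
Proof.
move=> ss h h'; apply: (eq_from_nth (x0 := None)) => // i si.
have [<- _] := word_event_nth h si.
by have [|<- _] := word_event_nth (i := i) h'; rewrite -?ss.
Qed.

Variable r : nat.

Definition blocks k (w : {ffun 'I_k -> r.-tuple (alphabet m)}) : seq (alphabet m) :=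
  bridged [seq tval (w j) | j <- enum 'I_k].

Lemma size_blocks k (w : {ffun 'I_k -> r.-tuple (alphabet m)}) :
  size (blocks w) = (k * r.+1)%N.
Proof.
rewrite /blocks /bridged size_flatten /shape -!map_comp.
rewrite (eq_map (g := fun=> r.+1)); last by move=> j /=; rewrite size_tuple.
by rewrite sumnE big_map big_const_seq count_predT iter_addn_0 -enumT -cardE card_ord mulnC.
Qed.

Lemma blocks_inj k : injective (@blocks k).
Proof.
move=> w w' e; apply/ffunP => j; apply: val_inj => /=.
have : shape [seq Some ord_max :: s | s <- [seq tval (w j) | j <- enum 'I_k]]
   = shape [seq Some ord_max :: s | s <- [seq tval (w' j) | j <- enum 'I_k]].
  rewrite /shape -!map_comp; apply: eq_map => i /=; by rewrite !size_tuple.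
move=> /(eq_from_flatten_shape e); rewrite -!map_comp => /eq_in_map /(_ j).
by move=> /(_ (mem_index_enum j)) [].
Qed.

Lemma prod_blocks k (w : {ffun 'I_k -> r.-tuple (alphabet m)}) :
  \prod_(a <- blocks w) pi_m a = bridge_prob pi_m ^+ k * prodw (prod_law pi_m) w.
Proof.
rewrite /blocks /bridged big_flatten big_map big_map big_enum /=.
under eq_bigr do rewrite big_cons.
rewrite big_split /= prodr_const card_ord; congr (_ * _).
by apply: eq_bigr => j _; rewrite /prod_law (big_tuple _ _ (w j)).
Qed.

Let N (n : nat) (t : T) := num_pieces (tent_iter (fun i => omega i t) n).

Lemma measurable_growth n (x : R) :
  measurable [set t | x < n%:R^-1 * ln (N n t)%:R].
Proof.
apply: (@measurable_num_pieces R d T (fun t => tent_iter (fun i => omega i t) n)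
  _ _ _ [set k | x < n%:R^-1 * ln k%:R]).
- by move=> t; exact: tent_iter_continuous.
- by move=> y; exact: measurable_tent_iter.
- by move=> t; exact: tent_iter_partition.
Qed.

Lemma growth_prob_ge k (x : R) : (0 < m)%N -> (0 < k)%N ->
  ((bridge_prob pi_m ^+ k * \sum_(w : {ffun 'I_k -> r.-tuple (alphabet m)} |
     [forall i, w i \in @Ggood R m r] && (k%:R * (r.+1%:R * x) < \sum_i ln (Gam (w i))))
   prodw (prod_law pi_m) w)%:E <=
   P [set t | (x < (k * r.+1)%:R^-1 * ln (N (k * r.+1) t)%:R)%R])%E.
Proof.
move=> m0 k0.
have mw (w : {ffun 'I_k -> r.-tuple (alphabet m)}) := measurable_word_event (blocks w).
rewrite mulr_sumr -big_filter -sumEFin.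
under eq_bigr do rewrite -prod_blocks -word_event_prob.
rewrite -(measure_disjoint_sum P (filter_uniq _ (index_enum_uniq _)) mw); last first.
  by move=> w w' t h /(word_event_inj _ h) e; apply: blocks_inj;
    apply: e; rewrite !size_blocks.
apply: le_measure; rewrite ?inE; first by apply: bigsetU_measurable => ? _; exact: mw.
  exact: measurable_growth.
rewrite big_filter; elim/big_ind: _ => //.
  by move=> A B hA hB t [/hA|/hB].
move=> w /andP[/forallP wG hx] t wt /=.
have Gp j : 0 < (Gam (w j) : R) by have := wG j; rewrite inE.
have := @prod_Gam_le R eps m eps01 (fun i => omega i t)
  [seq tval (w j) | j <- enum 'I_k] m0.
rewrite -/(blocks w) size_blocks big_map big_enum /= => hN.
have {}hN : \prod_j Gam (w j) <= (N (k * r.+1) t)%:R :> R.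
  by apply: hN => i; rewrite -(size_blocks w) => /(word_event_nth wt)[].
have kr : 0 < ((k * r.+1)%:R : R) by rewrite ltr0n muln_gt0 k0.
rewrite mulrC ltr_pdivlMr// mulrC natrM -mulrA (lt_le_trans hx)//.
have pG : 0 < \prod_j (Gam (w j) : R) by exact: prodr_gt0.
apply: (@le_trans _ _ (ln (\prod_j Gam (w j)))); last first.
  by rewrite ler_ln ?posrE// (lt_le_trans pG).
rewrite -[leLHS]expRK expR_sum; under eq_bigr do rewrite lnK ?posrE//.
exact: lexx.
Qed.

End Words.

Theorem theorem2p6 (R : realType) (eps : R) (eps01 : 0 < eps < 1)
    (mu : probability (param R) R) (mu_supp : mu (tent_dom eps) = 1%E)
    (d : measure_display) (T : measurableType d) (P : probability T R)
    (omega : nat -> {RV P >-> param R}) (omega_iid : iid mu omega)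
    (m r : nat) (m_ge1 : (1 <= m)%N) (r_ge1 : (1 <= r)%N) :
  let pi_m := kappa_law P eps m (omega 0%N) in
  let N (n : nat) (t : T) := num_pieces (tent_iter (fun i => omega i t) n) in
  let n_ (k : nat) := (1 + k * r + (k - 1))%N in
  0 < bridge_prob pi_m ->
  forall x : R,
    (- Jplus r pi_m x <=
     limn_einf (fun k : nat =>
       ((n_ k)%:R^-1)%:E *
       lne (P [set t | x < (n_ k)%:R^-1 * ln (N (n_ k) t)%:R]%R)))%E.
Proof.
move=> pi_m N n_ pb x.
rewrite leeNl; apply: le_ereal_inf_tmp => _ [nu [nupmf nuG nug] <-].
rewrite leeNl /rel_entropy; case: asboolP => [ac|_]; last first.
  by rewrite addye// gt0_mulye ?lte_fin ?invr_gt0 ?ltr0n// leNye.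
rewrite -EFinB -EFinM -EFinN; set H := \sum_w _.
set c := - _; apply/lee_addgt0Pr => e e0; rewrite -leeBlDr// -EFinB.
pose e' := e / 2; have e'0 : 0 < e' by rewrite divr_gt0.
have q0 (w : r.-tuple (alphabet m)) : 0 <= prod_law pi_m w.
  by apply: prodr_ge0 => i _; rewrite fine_ge0.
have [k0 hk0] := cramer_lower nupmf q0 ac nuG nug e'0.
pose k1 := maxn k0 (Num.truncn (ln 2 / e')).+1.
apply: (@limn_einf_ge _ _ _ k1) => k; rewrite geq_max => /andP[/hk0 hk kln].
have kgt0 : (0 < k)%N by apply: leq_trans kln.
have kR : 0 < k%:R :> R by rewrite ltr0n.
have nE : n_ k = (k * r.+1)%N.
  by rewrite /n_ addnAC subnKC// mulnS.
have := growth_prob_ge eps01 mu_supp omega_iid r x m_ge1 kgt0.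
rewrite nE -/pi_m -/(N _ _); set A := [set t | _].
set S := \sum_(w | _) _ in hk *.
have fA : P A \is a fin_num by rewrite fin_num_measure//; exact: measurable_growth.
rewrite -(fineK fA); set a := fine (P A); rewrite lee_fin => ha.
pose low := bridge_prob pi_m ^+ k * (2^-1 * expR (- (k%:R * (H + e')))).
have low0 : 0 < low by rewrite !mulr_gt0 ?exprn_gt0 ?expR_gt0 ?invr_gt0.
have lowa : low <= a by apply: le_trans ha; rewrite ler_wpM2l// exprn_ge0// ltW.
have a0 : 0 < a by apply: lt_le_trans lowa.
rewrite lne_EFin// -EFinM lee_fin.
have n0 : 0 < (k * r.+1)%:R :> R by rewrite ltr0n muln_gt0 kgt0.
rewrite ler_pdivlMl//; apply: (@le_trans _ _ (ln low)); last by rewrite ler_ln ?posrE.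
rewrite /low lnM ?posrE ?mulr_gt0 ?exprn_gt0 ?expR_gt0 ?invr_gt0//.
rewrite lnM ?posrE ?expR_gt0 ?invr_gt0// lnXn// lnV ?posrE// expRK.
have hln : ln 2 <= k%:R * e'.
  rewrite -ler_pdivrMr// ltW//; apply: lt_le_trans (truncnS_gt _) _.
  by rewrite ler_nat.
have hr : k%:R * e' <= k%:R * e' * r.+1%:R.
  by rewrite ler_peMr ?ler1n// mulr_ge0// ltW.
have eE : e = e' + e' by rewrite /e'; field.
have -> : (k * r.+1)%:R * (c - e) =
    k%:R * (ln (bridge_prob pi_m) - H) - (k%:R * e' * r.+1%:R)
      - (k%:R * e' * r.+1%:R) :> R.
  have rn : r.+1%:R != 0 :> R by rewrite pnatr_eq0.
  by rewrite /c eE natrM; move: (r.+1%:R : R) rn => s s0; field.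
rewrite -mulr_natl; lra.
Qed.
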